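(* Let $\mathcal{G}$ be a graph class in which every graph has sign-rank at most $3$. Then $\mathsf{D}^{\mathrm{Eq}}(\mathcal{G})=O(1)$ if and only if $\mathcal{G}$ is stable.
   Context: A graph class is a set of graphs closed under isomorphism. Sign-rank: for a bipartite graph $G=(X,Y,E)$ with fixed bipartition, the minimum rank of a real matrix $R\in\mathbb{R}^{X\times Y}$ with nonzero entries and $R_{x,y}>0$ iff $xy\in E$; for a general graph $G=(V,E)$, the minimum rank of a real $R\in\mathbb{R}^{V\times V}$ such that for all $i\neq j$, $R_{i,j}>0$ if $ij\in E$ and $R_{i,j}<0$ otherwise (no condition on the diagonal). Chain-index $\mathrm{ch}(G)$: the largest $k$ such that there are $2k$ distinct vertices $a_1,\dots,a_k,b_1,\dots,b_k$ with, for all $i<j$, $a_ib_j$ an edge and $b_ia_j$ a non-edge. $\mathcal{G}$ is stable if there is a constant $k$ with $\mathrm{ch}(G)\le k$ for all $G\in\mathcal{G}$. $\mathsf{D}^{\mathrm{Eq}}(M)$ for $M\in\{\pm1\}^{X\times Y}$: the minimum depth of a rooted binary tree in which each internal node $v$ carries functions $\alpha_v:X\to\mathbb{N}$, $\beta_v:Y\to\mathbb{N}$ and each leaf a value in $\{\pm1\}$, such that for every $(x,y)$, walking from the root (right child if $\alpha_v(x)=\beta_v(y)$, left otherwise) reaches a leaf with value $M(x,y)$. $\mathsf{D}^{\mathrm{Eq}}(\mathcal{G})=O(1)$ means there is a constant $c$ with $\mathsf{D}^{\mathrm{Eq}}(\mathrm{Adj}_G)\le c$ for all $G\in\mathcal{G}$,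 where $\mathrm{Adj}_G$ is the adjacency matrix of $G$ ($1$ iff adjacent, $-1$ otherwise), taken as the bipartite adjacency matrix $X\times Y$ when $\mathcal{G}$ is a class of bipartite graphs. *)

(* Defs.v *)
From HB Require Import structures.
From mathcomp Require Import all_boot all_order all_algebra.
From mathcomp Require Import boolp reals.

Set Implicit Arguments.
Unset Strict Implicit.
Unset Printing Implicit Defensive.

Import Order.TTheory GRing.Theory Num.Theory.
Local Open Scope ring_scope.

Record sgraph := SGraph {
  vertex :> finType;
  adj : rel vertex;
  adj_sym : symmetric adj;
  adj_irr : irreflexive adj }.

Record bigraph := BiGraph {
  lpart : finType;
  rpart : finType;
  edge : lpart -> rpart -> bool }.

Definition sgraph_iso (G H : sgraph) : Prop :=
  exists2 f : G -> H, bijective f & forall x y, adj (f x) (f y) = adj x y.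

Definition bigraph_iso (G H : bigraph) : Prop :=
  exists (f : lpart G -> lpart H) (g : rpart G -> rpart H),
    [/\ bijective f, bijective g & forall x y, edge (f x) (g y) = edge x y].

Definition graph_class (C : sgraph -> Prop) : Prop :=
  forall G H, sgraph_iso G H -> C G -> C H.

Definition bigraph_class (C : bigraph -> Prop) : Prop :=
  forall G H, bigraph_iso G H -> C G -> C H.

Definition bi_adj (G : bigraph) : rel (lpart G + rpart G)%type :=
  fun u v => match u, v with
  | inl x, inr y | inr y, inl x => edge x y
  | _, _ => false
  end.

Lemma bi_adj_sym G : symmetric (@bi_adj G).
Proof. by case=> [x|x] [y|y]. Qed.

Lemma bi_adj_irr G : irreflexive (@bi_adj G).
Proof. by case. Qed.

Definition sgraph_of_bi (G : bigraph) : sgraph :=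
  SGraph (@bi_adj_sym G) (@bi_adj_irr G).

Section SignRank.
Variable R : realType.

Definition sign_represents (G : sgraph) (A : 'M[R]_#|G|) : Prop :=
  forall x y : G, x != y ->
    if adj x y then 0 < A (enum_rank x) (enum_rank y)
    else A (enum_rank x) (enum_rank y) < 0.

Definition bi_sign_represents (G : bigraph)
    (A : 'M[R]_(#|lpart G|, #|rpart G|)) : Prop :=
  forall (x : lpart G) (y : rpart G),
    A (enum_rank x) (enum_rank y) != 0 /\
    (0 < A (enum_rank x) (enum_rank y) <-> edge x y).

Lemma sign_rank_ex (G : sgraph) :
  exists r, `[< exists2 A : 'M[R]_#|G|, sign_represents A & \rank A = r >].
Proof.
pose A : 'M[R]_#|G| :=
  \matrix_(i, j) if adj (enum_val i) (enum_val j) then 1 else -1.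
exists (\rank A); apply/asboolP; exists A => // x y _.
by rewrite !mxE !enum_rankK; case: (adj x y); rewrite /= ?oppr_lt0 ltr01.
Qed.

Lemma bi_sign_rank_ex (G : bigraph) :
  exists r, `[< exists2 A : 'M[R]_(#|lpart G|, #|rpart G|),
    bi_sign_represents A & \rank A = r >].
Proof.
pose A : 'M[R]_(#|lpart G|, #|rpart G|) :=
  \matrix_(i, j) if edge (enum_val i) (enum_val j) then 1 else -1.
exists (\rank A); apply/asboolP; exists A => // x y.
rewrite !mxE !enum_rankK; case: (edge x y) => /=; first by rewrite oner_eq0 ltr01.
by rewrite oppr_eq0 oner_eq0 oppr_gt0 ltr10.
Qed.

Definition sign_rank (G : sgraph) : nat := ex_minn (sign_rank_ex G).

Definition bi_sign_rank (G : bigraph) : nat := ex_minn (bi_sign_rank_ex G).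

End SignRank.

Definition has_chain (G : sgraph) (k : nat) : Prop :=
  exists a b : 'I_k -> G,
    [/\ injective a, injective b, forall i j, a i != b j &
        forall i j : 'I_k, (i < j)%N -> adj (a i) (b j) /\ ~~ adj (b i) (a j)].

Lemma has_chain_ex (G : sgraph) : exists k, `[< has_chain G k >].
Proof.
exists 0%N; apply/asboolP.
have e (i : 'I_0) : G by case: i.
by exists e, e; split; case.
Qed.

Lemma has_chain_le (G : sgraph) k : `[< has_chain G k >] -> (k <= #|G|)%N.
Proof.
by move=> /asboolP[a [b [/leq_card + _ _ _]]]; rewrite card_ord.
Qed.

Definition chain_index (G : sgraph) : nat :=
  ex_maxn (has_chain_ex G) (@has_chain_le G).

Definition stable (C : sgraph -> Prop) : Prop :=
  exists k, forall G, C G -> (chain_index G <= k)%N.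

Definition bi_stable (C : bigraph -> Prop) : Prop :=
  exists k, forall G, C G -> (chain_index (sgraph_of_bi G) <= k)%N.

(* The values 1 and -1 of sign matrices are encoded as true and false. *)
Inductive eqtree (X Y : Type) : Type :=
| EqLeaf of bool
| EqNode (alpha : X -> nat) (beta : Y -> nat) (left right : eqtree X Y).

Arguments EqLeaf {X Y} _.

Fixpoint eqtree_depth X Y (t : eqtree X Y) : nat :=
  match t with
  | EqLeaf _ => 0
  | EqNode _ _ l r => (maxn (eqtree_depth l) (eqtree_depth r)).+1
  end.

Fixpoint eqtree_eval X Y (t : eqtree X Y) (x : X) (y : Y) : bool :=
  match t with
  | EqLeaf b => b
  | EqNode alpha beta l r =>
      if alpha x == beta y then eqtree_eval r x y else eqtree_eval l x y
  end.

Definition computes X Y (t : eqtree X Y) (M : X -> Y -> bool) : Prop :=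
  forall x y, eqtree_eval t x y = M x y.

Lemma DEq_ex (X Y : finType) (M : X -> Y -> bool) :
  exists d, `[< exists2 t : eqtree X Y, computes t M & eqtree_depth t = d >].
Proof.
suff [t ht] : exists t : eqtree X Y,
    forall x y, x \in enum X -> eqtree_eval t x y = M x y.
  exists (eqtree_depth t); apply/asboolP; exists t => // x y.
  by apply: ht; rewrite mem_enum.
elim: (enum X) => [|x0 s [t ht]]; first by exists (EqLeaf true).
exists (EqNode (fun x => (x == x0) : nat) (fun=> 1%N) t
  (EqNode (fun=> 1%N) (fun y => M x0 y : nat) (EqLeaf false) (EqLeaf true))).
move=> x y; rewrite inE /=; case: eqVneq => [-> _|_ /= xs]; last exact: ht.
by case: (M x0 y).
Qed.

Definition DEq (X Y : finType) (M : X -> Y -> bool) : nat :=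
  ex_minn (DEq_ex M).

Definition DEq_bounded (C : sgraph -> Prop) : Prop :=
  exists c, forall G : sgraph, C G -> (DEq (@adj G) <= c)%N.

Definition bi_DEq_bounded (C : bigraph -> Prop) : Prop :=
  exists c, forall G : bigraph, C G -> (DEq (@edge G) <= c)%N.

(* Main.v *)
Require Import Defs.
From HB Require Import structures.
From mathcomp Require Import all_boot all_order all_algebra.
From mathcomp Require Import boolp reals.
From mathcomp Require Import zify lra ring.

(* Up to positive scaling of rows and columns and a split into boundedly many classes, a
   rank-3 sign matrix reads [M x y = (0 < al x + be y - f x * g y)] (points above lines),
   and such a matrix, ordered by [f] and [g], has no 2x2 identity submatrix.  Let [V] be a
   hitting set of minimum size for the nonempty columns.  Its elements have private
   columns, so every column meets [V] in an interval, and without long chains only boundedly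
   many intervals pass through a given element.  By minimality every column through a row
   [p] meets [V] next to [p]; so boundedly many intervals are possible for it and equality
   queries find the right one.  The columns with that interval have a complete row in [V].
   The same step for the complemented transpose yields an empty column; this row and
   column extend every remaining chain by one, so the chain length drops.
   Conversely, a Ramsey argument finds in a long chain a long subchain whose off-diagonal
   pairs all give the same answer to a given query, whence a constant subchain after
   boundedly many queries, which is absurd. *)

Set Implicit Arguments.
Unset Strict Implicit.
Unset Printing Implicit Defensive.

Import Order.TTheory GRing.Theory Num.Theory.

(** * Ramsey argument for the answers to one equality query *)

Lemma all_pairwise T (a : pred T) (r : rel T) s :
  (forall u v, a u -> a v -> r u v) -> all a s -> pairwise r s.
Proof.
move=> ar; elim: s => //= u s IH /andP[au as_]; rewrite IH // andbT.
by apply: sub_all as_ => v; apply: ar.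
Qed.

(** Greedy choice: keeping [u] rules out only the later [v] with [q v = p u] or [p v = q u], fewer
    than [2 * m] of them. *)
Lemma sparse_subseq (T : eqType) (p q : T -> nat) k m (s : seq T) :
  (forall z, count (fun u => p u == z) s < m) ->
  (forall z, count (fun u => q u == z) s < m) ->
  k * (2 * m).+1 <= size s ->
  exists2 t, subseq t s & size t = k /\
    pairwise (fun u v => (p u != q v) && (p v != q u)) t.
Proof.
elim: k s => [|k IH] s pm qm; first by exists [::]; rewrite ?sub0seq.
case: s pm qm => [|u s] /= pm qm ks; first by rewrite mulSn in ks.
pose a v := (p u != q v) && (p v != q u).
have ca : size s <= size (filter a s) + 2 * m.
  rewrite size_filter -(count_predC a s) leq_add2l.
  have /leq_trans-> // : count (predC a) s <=
      count (fun v => q v == p u) s + count (fun v => p v == q u) s.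
    rewrite -count_predUI; apply: leq_trans (leq_addr _ _).
    by apply: sub_count => v; rewrite /= /a negb_and !negbK eq_sym.
  by have := pm (q u); have := qm (p u); lia.
have sub c z : count (fun v : T => c v == z) (filter a s) <=
    (c u == z :> nat) + count (fun v => c v == z) s.
  apply: leq_trans (leq_addl _ _).
  by rewrite count_filter; apply: sub_count => v /= /andP[].
have [|||t ts [tk tp]] := IH (filter a s).
- by move=> z; apply: leq_ltn_trans (pm z); apply: sub.
- by move=> z; apply: leq_ltn_trans (qm z); apply: sub.
- by move: ks; rewrite mulSn; lia.
exists (u :: t).
  by rewrite /= eqxx (subseq_trans ts) // filter_subseq.
rewrite /= tk tp andbT; split=> //; apply/allP => v /(mem_subseq ts).
by rewrite mem_filter => /andP[].
Qed.

(** Where [p] is constantly [z], the answer is whether [q] equals [z], so the larger half of [2 * r]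
    such elements is homogeneous; likewise for [q]. If all values are rare, [sparse_subseq] makes
    every answer a no. *)
Lemma homogeneous_subseq r : exists n, forall (T : eqType) (p q : T -> nat) s,
  n <= size s -> exists c t, [/\ subseq t s, r <= size t &
    pairwise (fun u v => ((p u == q v) == c) && ((p v == q u) == c)) t].
Proof.
exists (r * (2 * (2 * r)).+1) => T.
have dense (p q : T -> nat) s z : 2 * r <= count (fun u => p u == z) s ->
    exists c t, [/\ subseq t s, r <= size t &
    pairwise (fun u v => ((p u == q v) == c) && ((p v == q u) == c)) t].
  rewrite -size_filter; set s1 := filter _ _.
  rewrite -(count_predC (fun u => q u == z) s1) => sz.
  have [c cr] : exists c, r <= count (fun u => (q u == z) == c) s1.
    have [h|h] := leqP r (count (fun u => q u == z) s1); [exists true|exists false].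
      by rewrite (eq_count (a2 := fun u => q u == z)) // => u; case: (q u == z).
    rewrite (eq_count (a2 := predC (fun u => q u == z))); first lia.
    by move=> u /=; case: (q u == z).
  exists c, (filter (fun u => (q u == z) == c) s1); split.
  - by rewrite (subseq_trans (filter_subseq _ _)) ?filter_subseq.
  - by rewrite size_filter.
  apply: (all_pairwise (a := fun u => (p u == z) && ((q u == z) == c))).
    by move=> u v /andP[/eqP-> +] /andP[/eqP->]; rewrite ![z == _]eq_sym => -> ->.
  apply/allP => u; rewrite !mem_filter => /andP[->].
  by rewrite andbT => /andP[].
move=> p q s ns.
have [[z pz]|np] := EM (exists z, 2 * r <= count (fun u => p u == z) s).
  exact: dense pz.
have [[z qz]|nq] := EM (exists z, 2 * r <= count (fun u => q u == z) s).
  have [c [t [ts tr tp]]] := dense q p s z qz; exists c, t; split=> //.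
  by apply: sub_pairwise tp => u v; rewrite andbC ![q _ == _]eq_sym.
have [||t ts [tr tp]] := @sparse_subseq _ p q r (2 * r) s _ _ ns.
- by move=> z; rewrite ltnNge; apply/negP => h; apply: np; exists z.
- by move=> z; rewrite ltnNge; apply/negP => h; apply: nq; exists z.
exists false, t; split=> //; first by rewrite tr.
by apply: sub_pairwise tp => u v; rewrite !eqbF_neg.
Qed.

(** * Chains, and their bounded length under bounded query depth *)

Section Chains.
Variables (X Y : finType).
Implicit Types (M : X -> Y -> bool) (A : {set X}) (B : {set Y}).

(* No condition relates [u.1] to [u.2]: this keeps the notion invariant under [cotranspose] below. *)
Definition chain M A B (s : seq (X * Y)) :=
  all (fun u => (u.1 \in A) && (u.2 \in B)) s &&
  pairwise (fun u v => M u.1 v.2 && ~~ M v.1 u.2) s.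

Definition chain_free M A B k := forall s, chain M A B s -> size s < k.

Lemma chainT M s : chain M setT setT s =
  pairwise (fun u v => M u.1 v.2 && ~~ M v.1 u.2) s.
Proof. by rewrite /chain (@eq_all _ _ predT) ?all_predT // => u; rewrite !inE. Qed.

Lemma chain_freeS M A B A' B' k : A' \subset A -> B' \subset B ->
  chain_free M A B k -> chain_free M A' B' k.
Proof.
move=> /subsetP sA /subsetP sB fr s /andP[sAB sp]; apply: fr; rewrite /chain sp.
by rewrite andbT; apply: sub_all sAB => u /andP[/sA-> /sB->].
Qed.

Lemma subseq_chain M A B s t : subseq s t -> chain M A B t -> chain M A B s.
Proof.
move=> st /andP[tAB tp]; rewrite /chain (subseq_pairwise st tp) andbT.
by apply/allP => u /(mem_subseq st) /(allP tAB).
Qed.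

End Chains.

Lemma eqtree_chain_bounded d : exists n, forall (X Y : finType) (t : eqtree X Y) s,
  eqtree_depth t <= d -> chain (eqtree_eval t) setT setT s -> size s < n.
Proof.
elim: d => [|d [n IH]].
  exists 2 => X Y [b|//] [|u [|v s]] //= _; rewrite chainT /=.
  by case: b; rewrite ?andbF.
have [m hm] := homogeneous_subseq n; exists m => X Y t s td cs.
rewrite ltnNge; apply/negP => ms.
case: t td cs => [b|al be l r] /=.
  (* The queries are dummies: only the length of the subsequence is used, to reach the bound [n]. *)
  move=> _ cs; have [c [t [ts tn _]]] := hm _ (fun=> 0) (fun=> 0) _ ms.
  by have := IH _ _ (EqLeaf b) t isT (subseq_chain ts cs); rewrite ltnNge tn.
rewrite ltnS geq_max => /andP[ld rd] cs.
have [c [t [ts tn tp]]] := hm _ (fun u => al u.1) (fun u => be u.2) _ ms.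
have := subseq_chain ts cs; rewrite chainT => ct.
(* A chain only sees off-diagonal pairs; there all answers are [c], so the tree acts as one of its
   children. *)
have := IH _ _ (if c then r else l) t; rewrite chainT ltnNge tn => H.
have /H : eqtree_depth (if c then r else l) <= d by case: (c).
move=> nc; suff : ~~ true by []; apply: nc.
have : pairwise (fun u v => (eqtree_eval (EqNode al be l r) u.1 v.2 &&
   ~~ eqtree_eval (EqNode al be l r) v.1 u.2) &&
   (((al u.1 == be v.2) == c) && ((al v.1 == be u.2) == c))) t.
  by rewrite pairwise_relI ct tp.
apply: sub_pairwise => u v /= /andP[h /andP[/eqP e1 /eqP e2]].
by move: h; rewrite e1 e2; case: (c).
Qed.

(** * Building equality protocols from smaller ones *)

Section Glue.
Variables (I X Y : Type) (ix : X -> I) (iy : Y -> I).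

Definition node_alpha (t : eqtree X Y) x := if t is EqNode a _ _ _ then a x else 0.
Definition node_beta (t : eqtree X Y) y := if t is EqNode _ b _ _ then b y else 0.
Definition node_left (t : eqtree X Y) := if t is EqNode _ _ l _ then l else t.
Definition node_right (t : eqtree X Y) := if t is EqNode _ _ _ r then r else t.
Definition leaf_value (t : eqtree X Y) := if t is EqLeaf b then b else false.

(* The answer at a leaf of [t i] depends on [i], which a leaf cannot; hence the last query. *)
Fixpoint eqtree_glue d (t : I -> eqtree X Y) : eqtree X Y :=
  if d is d.+1 then
    EqNode (fun x => node_alpha (t (ix x)) x) (fun y => node_beta (t (iy y)) y)
      (eqtree_glue d (fun i => node_left (t i)))
      (eqtree_glue d (fun i => node_right (t i)))
  else EqNode (fun x => leaf_value (t (ix x)) : nat) (fun=> 1)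
         (EqLeaf false) (EqLeaf true).

Lemma eqtree_glue_depth d t : eqtree_depth (eqtree_glue d t) = d.+1.
Proof. by elim: d t => //= d IH t; rewrite !IH maxnn. Qed.

Lemma eqtree_glue_eval d t x y : (forall i, eqtree_depth (t i) <= d) ->
  ix x = iy y -> eqtree_eval (eqtree_glue d t) x y = eqtree_eval (t (ix x)) x y.
Proof.
move=> td exy; elim: d t td => [|d IH] t td /=.
  by have := td (ix x); rewrite leqn0; case: (t (ix x)) => // -[].
rewrite -exy !IH.
- by case: (t (ix x)) => //= b; case: ifP.
- move=> i; have := td i; case: (t i) => //= _ _ l r.
  by rewrite ltnS geq_max => /andP[].
- move=> i; have := td i; case: (t i) => //= _ _ l r.
  by rewrite ltnS geq_max => /andP[].
Qed.

End Glue.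

(** Complementing along with transposing keeps chains in the same order, once the entries of each
    pair are swapped, and exchanges complete rows with empty columns. *)
Definition cotranspose (X Y : Type) (M : X -> Y -> bool) y x := ~~ M x y.

Fixpoint eqtree_cotranspose X Y (t : eqtree X Y) : eqtree Y X :=
  match t with
  | EqLeaf b => EqLeaf (~~ b)
  | EqNode a b l r => EqNode b a (eqtree_cotranspose l) (eqtree_cotranspose r)
  end.

Lemma eqtree_cotranspose_depth X Y (t : eqtree X Y) :
  eqtree_depth (eqtree_cotranspose t) = eqtree_depth t.
Proof. by elim: t => //= a b l -> r ->. Qed.

Lemma eqtree_cotranspose_eval X Y (t : eqtree X Y) :
  eqtree_eval (eqtree_cotranspose t) =2 cotranspose (eqtree_eval t).
Proof.
move=> y x; rewrite /cotranspose; elim: t => //= a b l -> r ->.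
by rewrite eq_sym; case: ifP.
Qed.

Definition DEq_on_le (X Y : finType) (A : {set X}) (B : {set Y})
    (M : X -> Y -> bool) d :=
  exists2 t : eqtree X Y, eqtree_depth t <= d &
    {in A & B, forall x y, eqtree_eval t x y = M x y}.

Lemma DEq_on_cotranspose (X Y : finType) (A : {set X}) (B : {set Y}) M d :
  DEq_on_le A B M d -> DEq_on_le B A (cotranspose M) d.
Proof.
case=> t td tM; exists (eqtree_cotranspose t); first by rewrite eqtree_cotranspose_depth.
by move=> y x yB xA; rewrite eqtree_cotranspose_eval /cotranspose tM.
Qed.

Lemma DEq_on_of_cotranspose (X Y : finType) (A : {set X}) (B : {set Y}) M d :
  DEq_on_le B A (cotranspose M) d -> DEq_on_le A B M d.
Proof.
move/DEq_on_cotranspose => [t td tM]; exists t => // x y xA yB.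
by rewrite tM // /cotranspose negbK.
Qed.

(* The row player runs through its short list of possible types of [y]. *)
Lemma DEq_on_fibers (X Y T : finType) (A : {set X}) (B : {set Y}) (M : X -> Y -> bool)
    (tp : Y -> T) (opts : X -> seq T) n d :
  {in A, forall x, size (opts x) <= n} ->
  {in A & B, forall x y, M x y -> tp y \in opts x} ->
  (forall i, DEq_on_le A (B :&: tp @^-1: [set i]) M d) ->
  DEq_on_le A B M (n + d.+1).
Proof.
move=> on om fib.
(* [None] covers the positions past the end of [opts x]; there the query is answered no, since [y]
   always announces a [Some]. *)
have /choice[t tP] : forall o : option T, exists t : eqtree X Y,
    eqtree_depth t <= d /\ forall i, o = Some i ->
    {in A & B :&: tp @^-1: [set i], forall x y, eqtree_eval t x y = M x y}.
  case=> [i|]; last by exists (EqLeaf false); split.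
  by have [t td tM] := fib i; exists t; split=> // _ [<-].
pose code (o : option T) : nat := enum_rank o.
pose loop := fix loop j := if j is j.+1 then
    EqNode (fun x => code (onth (opts x) j)) (fun y => code (Some (tp y)))
      (loop j) (eqtree_glue (fun x => onth (opts x) j) (fun y => Some (tp y)) d t)
  else EqLeaf false.
exists (loop n).
  elim: (n) => //= j IH; rewrite eqtree_glue_depth addSn ltnS geq_max IH.
  exact: leq_addl.
move=> x y xA yB.
(* Loop invariant: a true entry has its type among the first [j] options, so [false] is right once
   none is left. *)
have : M x y -> exists2 j, j < n & onth (opts x) j = Some (tp y).
  move=> /(om x y xA yB) tx; exists (index (tp y) (opts x)).
    by rewrite (leq_trans _ (on x xA)) // index_mem.
  by rewrite onthE (nth_map (tp y)) ?index_mem // nth_index.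
elim: (n) => [|j IH] hj /=.
  by apply/esym/negP => /hj[].
case: eqP => [/val_inj/enum_rank_inj e|ne].
  rewrite eqtree_glue_eval //; last by move=> o; case: (tP o).
  by rewrite e (proj2 (tP _) (tp y)) // !inE yB eqxx.
apply: IH => /hj[i]; rewrite ltnS leq_eqVlt => /orP[/eqP->|ij oi]; last by exists i.
by move=> oj; case: ne; rewrite oj.
Qed.

Lemma DEq_on_classes (X Y S T : finType) (A : {set X}) (B : {set Y}) (M : X -> Y -> bool)
    (cx : X -> S) (cy : Y -> T) d :
  (forall i j, DEq_on_le (A :&: cx @^-1: [set i]) (B :&: cy @^-1: [set j]) M d) ->
  DEq_on_le A B M (#|S| + (#|T| + d.+1).+1).
Proof.
move=> H; apply: DEq_on_of_cotranspose.
apply: (DEq_on_fibers (tp := cx) (opts := fun=> enum S)) => [x _|x y _ _ _|i].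
- by rewrite cardE.
- by rewrite mem_enum.
apply: DEq_on_cotranspose.
apply: (DEq_on_fibers (tp := cy) (opts := fun=> enum T)) => [x _|x y _ _ _|j].
- by rewrite cardE.
- by rewrite mem_enum.
exact: H.
Qed.

(** * Matrices without an ordered 2x2 identity *)

Section Slanted.
Variables (R : realType) (X Y : finType).
Implicit Types (M : X -> Y -> bool) (A : {set X}) (B : {set Y}).
Implicit Types (f : X -> R) (g : Y -> R).

(** The weak inequalities matter: two rows with equal keys admit the identity pattern in neither
    order, which gives [key_inj]. *)
Definition slanted M A B f g :=
  forall p q l m, p \in A -> q \in A -> l \in B -> m \in B ->
    (f p <= f q)%R -> (g l <= g m)%R ->
    ~~ [&& M p l, ~~ M p m, ~~ M q l & M q m].

Lemma slantedS M A B A' B' f g : A' \subset A -> B' \subset B ->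
  slanted M A B f g -> slanted M A' B' f g.
Proof.
move=> /subsetP sA /subsetP sB sl p q l m pA qA lB mB.
by apply: sl; [apply: sA|apply: sA|apply: sB|apply: sB].
Qed.

(** A half-turn preserves the identity pattern, so what is proved to the left of a row also holds to
    its right. *)
Lemma slanted_opp M A B f g : slanted M A B f g ->
  slanted M A B (fun x => - f x)%R (fun y => - g y)%R.
Proof.
move=> sl p q l m pA qA lB mB; rewrite !lerN2 => fqp gml.
have := sl q p m l qA pA mB lB fqp gml; apply: contra.
by case/and4P => -> -> -> ->.
Qed.

End Slanted.

(** Complementing turns the identity pattern into the antidiagonal one; reversing the order of [X]
    turns it back. *)
Lemma slanted_cotranspose (R : realType) (X Y : finType) (M : X -> Y -> bool) A B
    (f : X -> R) (g : Y -> R) :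
  slanted M A B f g -> slanted (cotranspose M) B A g (fun x => - f x)%R.
Proof.
move=> sl l m p q lB mB pA qA glm; rewrite lerN2 => fqp.
have := sl q p l m qA pA lB mB fqp glm; apply: contra; rewrite /cotranspose !negbK.
by case/and4P => -> -> -> ->.
Qed.

(** * Traces of columns on a set of rows *)

Section Traces.
Variables (X Y : finType) (M : X -> Y -> bool) (A : {set X}) (B : {set Y}).

Definition trace (V : {set X}) y := [set v in V | M v y].

(* An increasing sequence of traces is a chain: take for [a_i] a point of the next trace. *)
Lemma chain_of_traces (D : {set X}) (ss : seq {set X}) :
  D \subset A ->
  {in ss, forall S, exists2 y, y \in B & S = trace D y} ->
  pairwise (fun S T : {set X} => S \proper T) ss ->
  exists s, [/\ chain M A B s, size s = (size ss).-1 & forall S, S \in ss ->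
    head S ss = S -> all (fun u => [&& u.1 \in D, u.1 \notin S & S \subset trace D u.2]) s].
Proof.
move=> DA; elim: ss => [_ _|S1 [|S2 ss] IH trs].
- by exists [::].
- by move=> _; exists [::].
rewrite [pairwise _ _]/= => /andP[/andP[S12 _] ps].
have [s [cs zs /(_ S2 (mem_head _ _) erefl) as_]] :=
  IH (fun S Sss => trs S (mem_behead (s := [:: S1, S2 & ss]) Sss)) ps.
have [y yB e1] := trs S1 (mem_head _ _).
have [z zB e2] := trs S2 (mem_behead (s := [:: S1, S2 & ss]) (mem_head _ _)).
have [/subsetP sS [a aS2 aS1]] := properP S12.
have aD : a \in D by move: aS2; rewrite e2 inE => /andP[].
(* Later columns contain [S2], hence meet [a]; later rows avoid [S2], hence miss [y]. The clause on
   the first trace carries these facts through the induction. *)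
exists ((a, y) :: s); split.
- rewrite /chain /= (subsetP DA _ aD) yB /=.
  case/andP: (cs) => -> ->; rewrite !andbT /=.
  apply: sub_all as_ => u /and3P[uD uS2 /subsetP S2u].
  have := S2u _ aS2; rewrite inE aD => /= -> /=.
  by apply: contra uS2 => My; apply: sS; rewrite e1 inE uD.
- by rewrite /= zs.
move=> S _ /= <-; rewrite aD aS1 /= e1 subxx /= -e1.
apply: sub_all as_ => u /and3P[-> uS2 S2u] /=.
by rewrite (contra (sS _) uS2) (subset_trans (proper_sub S12) S2u).
Qed.

(** Sorted by size, a nested family is strictly increasing, and its chain is one shorter than the
    family. *)
Lemma card_nested_traces (D : {set X}) (F : {set {set X}}) k :
  D \subset A -> chain_free M A B k ->
  {in F, forall S, exists2 y, y \in B & S = trace D y} ->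
  {in F &, forall S T : {set X}, (S \subset T) || (T \subset S)} ->
  #|F| <= k.
Proof.
move=> DA fr trF nested.
pose r (S T : {set X}) := #|S| <= #|T|.
have rtr : transitive r by move=> S T U; apply: leq_trans.
have rto : total r by move=> S T; apply: leq_total.
have pF S : S \in sort r (enum F) -> S \in F by rewrite mem_sort mem_enum.
have [||s [cs zs _]] := @chain_of_traces D (sort r (enum F)) DA.
- by move=> S /pF; apply: trF.
- have : pairwise (fun S T => r S T && (S != T)) (sort r (enum F)).
    rewrite pairwise_relI -sorted_pairwise // sort_sorted //=.
    by rewrite -uniq_pairwise sort_uniq enum_uniq.
  apply: (@sub_in_pairwise _ (mem F)); last by apply/allP => S /pF.
  move=> S T SF TF /andP[rST neST]; rewrite properEneq neST /=.
  case/orP: (nested S T SF TF) => // TS; move: neST.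
  by move: rST; rewrite /r eq_sym eqEcard TS => ->.
by have := fr s cs; rewrite zs size_sort -cardE; case: #|F|.
Qed.

End Traces.

(** * Minimum hitting sets of the nonempty columns *)

Section HittingSet.
Variables (X Y : finType) (M : X -> Y -> bool) (A : {set X}) (B : {set Y}).

Definition hitting (V : {set X}) := (V \subset A) &&
  [forall y in B, [exists x in A, M x y] ==> [exists v in V, M v y]].

Lemma hittingP (V : {set X}) : reflect (V \subset A /\ forall x y, x \in A -> y \in B -> M x y ->
  exists2 v, v \in V & M v y) (hitting V).
Proof.
apply: (iffP andP) => -[VA h]; split=> //.
  move=> x y xA yB Mxy; have /forall_inP/(_ y yB)/implyP hy := h.
  by apply/exists_inP/hy/exists_inP; exists x.
apply/forall_inP => y yB; apply/implyP => /exists_inP[x xA Mxy].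
exact/exists_inP/h/Mxy.
Qed.

Variable V : {set X}.
Hypothesis hitV : hitting V.
Hypothesis minV : forall W, hitting W -> #|V| <= #|W|.

Let VA : V \subset A. Proof. by case/andP: hitV. Qed.
Let inA v : v \in V -> v \in A. Proof. exact/subsetP/VA. Qed.

(** Otherwise [V :\ v] would still hit every nonempty column. *)
Lemma private_column v : v \in V ->
  exists y, [/\ y \in B, M v y & forall w, w \in V -> M w y -> w = v].
Proof.
move=> vV; have : ~~ hitting (V :\ v).
  apply/negP => /minV; rewrite (cardsD1 v V) vV; lia.
have [_ hV] := hittingP _ hitV.
move=> nh; apply: contrapT => npr; move/hittingP: nh; apply; split.
  by rewrite (subset_trans _ VA) // subsetDl.
move=> x y xA yB Mxy; apply: contrapT => nv; apply: npr.
have only w : w \in V -> M w y -> w = v.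
  move=> wV Mw; apply/eqP/negPn/negP => wv; apply: nv; exists w => //.
  by rewrite !inE wv wV.
have [v' v'V Mv'] := hV _ _ xA yB Mxy.
by exists y; split=> //; rewrite -(only v').
Qed.

Section Keys.
Variables (R : realType) (f : X -> R) (g : Y -> R).
Hypothesis sl : slanted M A B f g.

(** If [v] missed [y], a private column [z] of [v] would form an identity with [y]: on rows [u], [v]
    if [z] is to the right of [y], on [v], [w] otherwise. *)
Lemma trace_convex u v w y : u \in V -> v \in V -> w \in V -> y \in B ->
  (f u <= f v)%R -> (f v <= f w)%R -> M u y -> M w y -> M v y.
Proof.
move=> uV vV wV yB uv vw Mu Mw; apply/negPn/negP => Mv.
have [z [zB Mvz only]] := private_column vV.
have notz t : t \in V -> M t y -> ~~ M t z.
  move=> tV Mt; apply/negP => Mtz; case/negP: Mv.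
  by rewrite -(only t tV Mtz).
have [gyz|/ltW gzy] := leP (g y) (g z).
  have := sl (inA uV) (inA vV) yB zB uv gyz.
  by rewrite Mu Mvz Mv notz.
have := sl (inA vV) (inA wV) zB yB vw gzy.
by rewrite Mw Mvz Mv notz.
Qed.

Lemma key_inj : {in V &, injective f}.
Proof.
move=> u v uV vV fuv; apply/eqP/negPn/negP => nuv.
have [y [yB Muy only_u]] := private_column uV.
have [z [zB Mvz only_v]] := private_column vV.
have Muz : ~~ M u z by apply/negP => /(only_v u uV) e; rewrite e eqxx in nuv.
have Mvy : ~~ M v y by apply/negP => /(only_u v vV) e; rewrite e eqxx in nuv.
have [gyz|/ltW gzy] := leP (g y) (g z).
  have := sl (inA uV) (inA vV) yB zB; rewrite fuv lexx => /(_ isT gyz).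
  by rewrite Muy Mvz Muz Mvy.
have := sl (inA vV) (inA uV) zB yB; rewrite fuv lexx => /(_ isT gzy).
by rewrite Muy Mvz Muz Mvy.
Qed.

Definition between w p := [set u in V | (f w < f u <= f p)%R].

(** For injective keys, these are the last two elements of [V] with key at most [f p], or fewer if
    [V] has fewer there. *)
Definition anchors p := [set w in V | (f w <= f p)%R && (#|between w p| <= 1)].

(** Moving an anchor to the left strictly enlarges [between], so its size, [0] or [1], determines
    the anchor. *)
Lemma card_anchors p : #|anchors p| <= 2.
Proof.
have inj : {in anchors p &, injective (fun w => inord #|between w p| : 'I_2)}.
  have lt_card u w : u \in anchors p -> w \in anchors p -> (f u < f w)%R ->
      #|between w p| < #|between u p|.
    rewrite !inE => /and3P[uV up _] /and3P[wV wp _] uw; apply: proper_card.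
    apply/properP; split.
      apply/subsetP => t; rewrite !inE => /and3P[-> wt ->].
      by rewrite (lt_trans uw wt).
    by exists w; rewrite !inE wV ?uw ?wp // ltxx.
  move=> u w uP wP /(congr1 (@nat_of_ord 2)).
  have bd t : t \in anchors p -> #|between t p| < 2.
    by rewrite !inE ltnS => /and3P[].
  rewrite !inordK ?bd // => e.
  have [uV wV] : u \in V /\ w \in V by move: uP wP; rewrite !inE => /andP[-> _] /andP[->].
  apply: key_inj => //.
  case: (ltgtP (f u) (f w)) => // h; have := lt_card _ _ _ _ h; rewrite e ltnn.
    by move=> /(_ uP wP).
  by move=> /(_ wP uP).
by rewrite -(card_in_imset inj) (leq_trans (max_card _)) ?card_ord.
Qed.

(* If two elements of [V] separated [p] from the column, they could be traded for [p]. *)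
Lemma anchor_exists p y w0 : p \in A -> y \in B -> M p y ->
  w0 \in V -> M w0 y -> (f w0 <= f p)%R -> exists2 w, w \in anchors p & M w y.
Proof.
move=> pA yB Mpy w0V Mw0 w0p.
pose P w := [&& w \in V, M w y & (f w <= f p)%R].
have Pw0 : P w0 by rewrite /P w0V Mw0.
case: (arg_maxP f Pw0) => w /and3P[wV Mwy wp] wmax.
exists w => //; rewrite !inE wV wp /=.
set S := between w p.
have nS u : u \in S -> ~~ M u y.
  rewrite inE => /and3P[uV wu up]; apply/negP => Muy.
  have /(lt_le_trans wu) : (f u <= f w)%R by apply: wmax; rewrite /P uV Muy.
  by rewrite ltxx.
(* A column [m] met by [u] in [S] but missed by [w] cannot lie to the right of [y], because of rows
   [w], [u]; so it lies to the left, and rows [u], [p] force [M p m]. *)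
have hit : hitting (p |: V :\: S).
  have [_ hV] := hittingP _ hitV.
  apply/hittingP; split.
    by rewrite subUset sub1set pA (subset_trans (subsetDl _ _) VA).
  move=> x m xA mB Mxm; have [u uV Mum] := hV _ _ xA mB Mxm.
  have [uS|uS] := boolP (u \in S); last by exists u; rewrite // in_setU1 in_setD uV uS orbT.
  have [Mwm|Mwm] := boolP (M w m).
    by exists w => //; rewrite in_setU1 in_setD inE wV ltxx orbT.
  exists p; first by rewrite !inE eqxx.
  have [_ wu up] : [/\ u \in V, (f w < f u)%R & (f u <= f p)%R].
    by move: uS; rewrite inE => /and3P[].
  have [gym|/ltW gmy] := leP (g y) (g m).
    have := sl (inA wV) (inA uV) yB mB (ltW wu) gym.
    by rewrite Mwy Mwm (nS u uS) Mum.
  have := sl (inA uV) pA mB yB up gmy.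
  by rewrite Mum (nS u uS) Mpy andbT /= negbK.
have := minV hit; have SV : S \subset V by apply/subsetP => u; rewrite inE => /andP[].
rewrite cardsU1 (cardsD V) (setIidPr SV) => h.
have := subset_leq_card SV; have : (p \notin V :\: S) <= 1 by case: (_ \notin _).
lia.
Qed.

(** By [trace_convex], the left part of a trace through [w] is an interval of [V] ending at [w], and
    such intervals are nested. *)
Lemma card_left_traces w k : chain_free M A B k -> w \in V ->
  #|[set [set v in trace M V y | (f v <= f w)%R] | y in B & M w y]| <= k.
Proof.
move=> fr wV; pose D := [set v in V | (f v <= f w)%R].
have tD y : [set v in trace M V y | (f v <= f w)%R] = trace M D y.
  by apply/setP => v; rewrite !inE andbAC.
apply: (card_nested_traces (D := D)) fr _ _.
- by rewrite (subset_trans _ VA) //; apply/subsetP => v; rewrite inE => /andP[].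
- move=> _ /imsetP[y + ->]; rewrite inE => /andP[yB _].
  by exists y => //.
move=> _ _ /imsetP[y + ->] /imsetP[z + ->]; rewrite !inE => /andP[yB My] /andP[zB Mz].
rewrite !tD; have [//|/subsetPn[v]] := boolP (trace M D y \subset _).
rewrite !inE => /andP[/andP[vV vw] Mv] nv; apply/subsetP => t.
rewrite !inE => /andP[/andP[tV tw] Mt]; rewrite tV tw /=.
move: nv; rewrite vV vw /= => nv.
have [vt|/ltW tv] := leP (f v) (f t); first exact: (trace_convex vV tV wV).
by case/negP: nv; apply: (trace_convex tV vV wV).
Qed.

End Keys.

End HittingSet.

Lemma card_bigcup_le (I T : finType) (P : {set I}) (F : I -> {set T}) n :
  {in P, forall i, #|F i| <= n} -> #|\bigcup_(i in P) F i| <= #|P| * n.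
Proof.
move=> Fn; apply: (@leq_trans (\sum_(i in P) #|F i|)).
  elim/big_rec2: _ => [|i m S _ Sm]; first by rewrite cards0.
  by rewrite (leq_trans (leq_card_setU _ _)) ?leq_add2l.
by rewrite (leq_trans (leq_sum _ (fun i iP => Fn i iP))) // sum_nat_const.
Qed.

(** * Induction on the chain length *)

Section Step.
Variables (R : realType) (X Y : finType) (M : X -> Y -> bool).
Variables (A : {set X}) (B : {set Y}) (f : X -> R) (g : Y -> R) (k : nat).
Hypothesis sl : slanted M A B f g.
Hypothesis fr : chain_free M A B k.

Section Types.
Variable V : {set X}.
Hypothesis hitV : hitting M A B V.
Hypothesis minV : forall W, hitting M A B W -> #|V| <= #|W|.

Definition traces_through x := [set trace M V y | y in B & M x y].

(** A trace through [w] is the union of its parts to the left and right of [w], with at most [k]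
    choices each. *)
Lemma card_traces_through_hit w : w \in V -> #|traces_through w| <= k * k.
Proof.
move=> wV.
have := leq_mul (card_left_traces hitV minV sl fr wV)
  (card_left_traces hitV minV (slanted_opp sl) fr wV).
apply: leq_trans; rewrite -cardsX; set FF := setX _ _.
apply: leq_trans (leq_imset_card (fun ST => ST.1 :|: ST.2) FF).
apply: subset_leq_card; apply/subsetP => _ /imsetP[y yB ->].
apply/imsetP; exists ([set v in trace M V y | (f v <= f w)%R],
  [set v in trace M V y | (- f v <= - f w)%R]).
  by rewrite inE; apply/andP; split; apply/imsetP; exists y.
apply/setP => v; rewrite !inE lerN2 /= -andb_orr.
by rewrite le_total andbT.
Qed.

(** Each such trace also passes through one of the at most two anchors of [x] on either side. *)
Lemma card_traces_through x : x \in A -> #|traces_through x| <= 4 * (k * k).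
Proof.
move=> xA.
pose P := anchors V f x :|: anchors V (fun u => - f u)%R x.
apply: (@leq_trans (#|P| * (k * k))); last first.
  rewrite leq_mul2r (leq_trans (leq_card_setU _ _)) ?orbT //.
  exact: leq_add (card_anchors hitV minV sl x) (card_anchors hitV minV (slanted_opp sl) x).
apply: (leq_trans _ (card_bigcup_le (P := P) (F := traces_through) _)); last first.
  move=> w wP; apply: card_traces_through_hit.
  by move: wP; rewrite !inE => /orP[] /andP[].
apply: subset_leq_card; apply/subsetP => _ /imsetP[y + ->].
rewrite inE => /andP[yB Mxy].
have [VA hV] := hittingP _ _ _ _ hitV; have [w0 w0V Mw0] := hV _ _ xA yB Mxy.
suff [w wP Mwy] : exists2 w, w \in P & M w y.
  by apply/bigcupP; exists w => //; apply/imsetP; exists y => //; rewrite inE yB.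
have [w0x|/ltW xw0] := leP (f w0) (f x).
  have [w wa Mw] := anchor_exists hitV minV sl xA yB Mxy w0V Mw0 w0x.
  by exists w; rewrite // inE wa.
have xw0' : (- f w0 <= - f x)%R by rewrite lerN2.
have [w wa Mw] := anchor_exists hitV minV (slanted_opp sl) xA yB Mxy w0V Mw0 xw0'.
by exists w; rewrite // inE wa orbT.
Qed.

End Types.

(** The type of a column is its trace on a minimum hitting set: an empty trace means an empty
    column, and any element of a nonempty trace is a row complete on the fiber. *)
Lemma DEq_on_step d :
  (forall (B' : {set Y}) v, B' \subset B -> v \in A -> {in B', forall y, M v y} ->
    DEq_on_le A B' M d) ->
  DEq_on_le A B M (4 * (k * k) + d.+1).
Proof.
move=> H.
have hitA : hitting M A B A.
  by apply/hittingP; split=> // x y xA _ Mxy; exists x.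
case: (arg_minnP (fun V : {set X} => #|V|) hitA) => V hitV minV.
apply: (DEq_on_fibers (tp := trace M V) (opts := fun x => enum (traces_through V x))).
- by move=> x xA; rewrite -cardE; apply: card_traces_through.
- move=> x y xA yB Mxy; rewrite mem_enum; apply/imsetP; exists y => //.
  by rewrite inE yB.
move=> S; have [->|[v vS]] := set_0Vmem S.
  exists (EqLeaf false) => // x y xA; rewrite !inE => /andP[yB /eqP trV] /=.
  apply/esym/negP => Mxy.
  have [_ /(_ x y xA yB Mxy)[v vV Mv]] := hittingP _ _ _ _ hitV.
  by move/setP/(_ v): trV; rewrite !inE vV Mv.
have vy y : y \in B :&: trace M V @^-1: [set S] -> v \in V /\ M v y.
  by rewrite !inE => /andP[_ /eqP e]; move: vS; rewrite -e inE => /andP.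
have [vV|nvV] := boolP (v \in V); last first.
  exists (EqLeaf false) => // x y _ /vy[vV]; by rewrite vV in nvV.
apply: (H _ v); first exact: subsetIl.
  by have [/subsetP/(_ v vV)] := hittingP _ _ _ _ hitV.
by move=> y /vy[].
Qed.

End Step.

Lemma slanted_DEq_bounded k : exists d, forall (R : realType) (X Y : finType)
    (M : X -> Y -> bool) A B (f : X -> R) (g : Y -> R),
  slanted M A B f g -> chain_free M A B k -> DEq_on_le A B M d.
Proof.
elim: k => [|k [d IH]].
  by exists 0 => R X Y M A B f g _ /(_ [::] isT).
pose n := 4 * (k.+1 * k.+1).
exists (n + (n + d.+1).+1) => R X Y M A B f g sl fr.
apply: (DEq_on_step sl fr) => B' v sB vA Mv; apply: DEq_on_of_cotranspose.
have sl' := slanted_cotranspose (slantedS (subxx A) sB sl).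
have fr' : chain_free (cotranspose M) B' A k.+1.
  move=> s cs; rewrite -(size_map (fun u => (u.2, u.1))); apply: fr.
  case/andP: cs => sBA sp; rewrite /chain all_map pairwise_map.
  apply/andP; split.
    by apply: sub_all sBA => u /andP[uB uA] /=; rewrite uA (subsetP sB).
  by apply: sub_pairwise sp => u w /=; rewrite /cotranspose negbK andbC.
apply: (DEq_on_step sl' fr') => A' l sA lB' Ml; apply: DEq_on_cotranspose.
apply: (IH _ _ _ _ _ _ f g); first exact: slantedS sl.
(* Row [v] is complete on [B'] and column [l] is empty on [A'], so [(v, l)] extends every chain at
   the front. *)
move=> s cs; apply: (fr ((v, l) :: s)); rewrite /chain /=.
case/andP: cs => sAB ->; rewrite vA (subsetP sB) //= andbT; apply/andP; split.
  by apply: sub_all sAB => u /andP[uA uB]; rewrite (subsetP sA) ?(subsetP sB).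
by apply: sub_all sAB => u /andP[uA uB]; rewrite Mv //; apply: Ml.
Qed.

(** * From rank three to slanted matrices *)

Lemma rank_le_factor (F : fieldType) r m n (A : 'M[F]_(m, n)) : \rank A <= r ->
  exists (U : 'M[F]_(m, r)) (W : 'M[F]_(r, n)), A = (U *m W)%R.
Proof.
move=> Ar; exists (col_ebase A *m pid_mx (\rank A))%R, (pid_mx (\rank A) *m row_ebase A)%R.
rewrite mulmxA -[(_ *m pid_mx _ *m pid_mx _)%R]mulmxA mul_pid_mx minnn (minn_idPr Ar).
by rewrite mulmx_ebase.
Qed.

Section SignOfBilinear.
Local Open Scope ring_scope.
Variables (R : realType) (X Y : finType).

(** The alternating sum of the four entries is minus the product of the two key differences, hence
    at most [0]; the identity pattern would make it positive. *)
Lemma slanted_bilinear (al f : X -> R) (be g : Y -> R) :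
  slanted (fun x y => 0 < al x + be y - f x * g y) setT setT f g.
Proof.
move=> p q l m _ _ _ _ fpq glm; apply/negP => /and4P[].
rewrite -!leNgt => pl pm ql qm.
have : 0 <= (f q - f p) * (g m - g l) by rewrite mulr_ge0 ?subr_ge0.
lra.
Qed.

Lemma sgr_of_signs (x y : R) : (0 < x, x < 0) = (0 < y, y < 0) -> Num.sg x = Num.sg y.
Proof.
case=> p n; case: (ltgtP 0 x) p n => [x0|x0|<-].
- by move=> y0 _; rewrite !gtr0_sg // -y0.
- by move=> _ y0; rewrite !ltr0_sg // -y0.
by rewrite sgr0; case: (ltgtP 0 y) => // <-; rewrite sgr0.
Qed.

(** The value [1] at [c = 0] keeps the factor positive, so that rescaling never changes a sign. *)
Definition rescale (c : R) := if c == 0 then 1 else `|c|^-1.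

Lemma rescale_gt0 c : 0 < rescale c.
Proof.
by rewrite /rescale; case: eqVneq => [_|c0]; rewrite ?ltr01 // invr_gt0 normr_gt0.
Qed.

Lemma rescale_mul c : rescale c * c = Num.sg c.
Proof.
rewrite /rescale; case: eqVneq => [->|c0]; first by rewrite mulr0 sgr0.
by rewrite {2}[c]numEsg mulrCA mulVf ?mulr1 // normr_eq0.
Qed.

End SignOfBilinear.

Lemma sign_matrix_DEq_bounded k : exists d, forall (R : realType) (X Y : finType)
    (u1 u2 u3 : X -> R) (v1 v2 v3 : Y -> R) (M : X -> Y -> bool),
  (forall x y, M x y = (0 < u1 x * v1 y + u2 x * v2 y + u3 x * v3 y)%R) ->
  chain_free M setT setT k -> DEq_on_le setT setT M d.
Proof.
have [d hd] := slanted_DEq_bounded k.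
exists (4 + (4 + d.+1).+1) => R X Y u1 u2 u3 v1 v2 v3 M Me fr.
have c4 : #|{: bool * bool}| = 4 by rewrite card_prod card_bool.
(* Each pair of comparisons records a sign, zero included. *)
rewrite -c4; apply: (DEq_on_classes (cx := fun x => (0 < u3 x, u3 x < 0)%R)
  (cy := fun y => (0 < v2 y, v2 y < 0)%R)) => i j.
rewrite !setTI; set A := _ @^-1: _; set B := _ @^-1: _.
have frAB : chain_free M A B k by apply: chain_freeS fr; rewrite ?subsetT.
have [A0|[x0 x0A]] := set_0Vmem A.
  apply: (hd R X Y M A B (fun=> 0%R) (fun=> 0%R)) frAB => p; by rewrite A0 inE.
have [B0|[y0 y0B]] := set_0Vmem B.
  by apply: (hd R X Y M A B (fun=> 0%R) (fun=> 0%R)) frAB => p q l m _ _; rewrite B0 inE.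
have sA x : x \in A -> Num.sg (u3 x) = Num.sg (u3 x0).
  by move=> xA; apply: sgr_of_signs; move: xA x0A; rewrite !inE => /eqP-> /eqP->.
have sB y : y \in B -> Num.sg (v2 y) = Num.sg (v2 y0).
  by move=> yB; apply: sgr_of_signs; move: yB y0B; rewrite !inE => /eqP-> /eqP->.
(* After positive rescaling [u3] and [v2] are constant on the class, leaving a single
   product [u1 * v1]. *)
pose a x := rescale (u3 x); pose b y := rescale (v2 y).
pose f x : R := (- (a x * u1 x))%R; pose g y : R := (b y * v1 y)%R.
pose al x : R := (a x * u2 x * Num.sg (v2 y0))%R.
pose be y : R := (Num.sg (u3 x0) * (b y * v3 y))%R.
have Mfg x y : x \in A -> y \in B -> M x y = (0 < al x + be y - f x * g y)%R.
  move=> xA yB; rewrite Me -(pmulr_rgt0 _ (mulr_gt0 (rescale_gt0 (u3 x)) (rescale_gt0 (v2 y)))).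
  congr (0 < _)%R; rewrite /al /be /f /g -(sA x xA) -(sB y yB) -!rescale_mul /a /b.
  ring.
apply: (hd R X Y M A B f g) frAB => p q l m pA qA lB mB fpq glm.
by rewrite !Mfg //; apply: slanted_bilinear fpq glm.
Qed.

Lemma rank3_DEq_bounded k : exists d, forall (R : realType) (X Y : finType)
    (A : 'M[R]_(#|X|, #|Y|)) (M : X -> Y -> bool), \rank A <= 3 ->
  (forall x y, M x y = (0 < A (enum_rank x) (enum_rank y))%R) ->
  chain_free M setT setT k -> DEq_on_le setT setT M d.
Proof.
have [d hd] := sign_matrix_DEq_bounded k; exists d => R X Y A M A3 Me.
have [U [W UW]] := rank_le_factor A3.
pose u i x := U (enum_rank x) (inord i); pose v i y := W (inord i) (enum_rank y).
apply: (hd R X Y (u 0) (u 1) (u 2) (v 0) (v 1) (v 2)) => x y.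
rewrite Me UW mxE !big_ord_recr big_ord0 /= add0r /u /v.
congr (0 < U _ _ * W _ _ + U _ _ * W _ _ + U _ _ * W _ _)%R;
  by apply: val_inj; rewrite /= inordK.
Qed.

(** * Chain index of graphs and query depth *)

Lemma DEq_le_iff (X Y : finType) (M : X -> Y -> bool) d :
  DEq M <= d <-> DEq_on_le setT setT M d.
Proof.
rewrite /DEq; case: ex_minnP => m /asboolP[t tM <-] mmin; split=> [td|[s sd sM]].
  by exists t => // x y _ _; apply: tM.
apply: leq_trans sd; apply: mmin; apply/asboolP; exists s => // x y.
by apply: sM; rewrite inE.
Qed.

Lemma chain_index_le_iff (G : sgraph) k :
  (forall n, has_chain G n -> n <= k) <-> chain_index G <= k.
Proof.
rewrite /chain_index; case: ex_maxnP => m /asboolP hm mmax; split=> [|mk n hn].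
  exact.
by apply: leq_trans mk; apply: mmax; apply/asboolP.
Qed.

Lemma has_chain_seq (G : sgraph) n : has_chain G n ->
  exists2 s, chain (@adj G) setT setT s & size s = n.
Proof.
move=> [a [b [_ _ _ ab]]]; exists [seq (a i, b i) | i <- enum 'I_n]; last first.
  by rewrite size_map size_enum_ord.
rewrite chainT pairwise_map.
have : pairwise ltn (map val (enum 'I_n)).
  by rewrite val_enum_ord -sorted_pairwise ?iota_ltn_sorted //; exact: ltn_trans.
rewrite pairwise_map; apply: sub_pairwise => i j /= ij.
by have [-> +] := ab i j ij; rewrite (adj_sym (a j)).
Qed.

Lemma DEq_bounded_stable c : exists k, forall G : sgraph,
  DEq (@adj G) <= c -> chain_index G <= k.
Proof.
have [k hk] := eqtree_chain_bounded c; exists k => G /DEq_le_iff[t td tM].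
apply/chain_index_le_iff => n /has_chain_seq[s cs <-]; apply/ltnW/(hk _ _ t _ td).
move: cs; rewrite !chainT; apply: sub_pairwise => u v.
by rewrite !tM ?inE.
Qed.

(* The matrix [M] is free on the diagonal, hence the extraction of a subchain with
   [a_i != b_j]. *)
Lemma seq_has_chain k : exists n, forall (G : sgraph) (M : G -> G -> bool) s,
  (forall x y, x != y -> M x y = adj x y) ->
  chain M setT setT s -> n <= size s -> has_chain G k.
Proof.
(* The construction uses [k.*2] pairs; the [4] guarantees the three pairs that refute the answer
   yes. *)
have [n hn] := homogeneous_subseq (k.*2 + 4); exists n => G M s Madj cs ns.
have [c [t [ts tk tp]]] :=
  hn _ (fun u => enum_rank u.1 : nat) (fun u => enum_rank u.2 : nat) s ns.
have ct' := subseq_chain ts cs.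
have {}tp : pairwise (fun u v : G * G => ((u.1 == v.2) == c) && ((v.1 == u.2) == c)) t.
  by apply: sub_pairwise tp => u v /=; rewrite !(inj_eq val_inj) !(inj_eq enum_rank_inj).
rewrite chainT in ct'.
clear s cs ns ts.
(* Were all answers yes, the entries of the first three pairs would coincide, and [M] would be both
   true and false at one point. *)
have c0 : c = false.
  apply/negP => c1; rewrite {}c1 in tp.
  case: t tk tp ct' => [|u [|v [|w t]]]; rewrite ?addn4 //= => _.
  rewrite !eqb_id => /and3P[/and3P[/andP[/eqP uv /eqP vu] /andP[/eqP uw /eqP wu] _]].
  move=> /andP[/andP[/eqP vw _] _] _ /andP[/andP[+ _] _].
  by rewrite -uv -vu uw -vw andbN.
rewrite {}c0 in tp.
case: t tk tp ct' => [|x0 t]; first by rewrite addn4.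
set s := x0 :: t => sk tp cs.
have in_s j : j < k.*2 -> j \in gtn (size s) by move=> jk; rewrite inE; lia.
have ne i j : i < k.*2 -> j < k.*2 -> i != j -> (nth x0 s i).1 != (nth x0 s j).2.
  move=> ik jk; rewrite neq_ltn => /orP[] ij.
    by have /andP[/eqP/negbT] := pairwiseP x0 tp _ _ (in_s i ik) (in_s j jk) ij.
  by have /andP[_ /eqP/negbT] := pairwiseP x0 tp _ _ (in_s j jk) (in_s i ik) ij.
have adjT i j : i < j -> j < k.*2 -> adj (nth x0 s i).1 (nth x0 s j).2.
  move=> ij jk; have ik := ltn_trans ij jk; rewrite -Madj; last by rewrite ne // neq_ltn ij.
  by have /andP[] := pairwiseP x0 cs _ _ (in_s i ik) (in_s j jk) ij.
have adjF i j : i < j -> j < k.*2 -> ~~ adj (nth x0 s j).1 (nth x0 s i).2.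
  move=> ij jk; have ik := ltn_trans ij jk; rewrite -Madj; last by rewrite ne // neq_ltn ij orbT.
  by have /andP[] := pairwiseP x0 cs _ _ (in_s i ik) (in_s j jk) ij.
have ev (i : 'I_k) : i.*2 < k.*2 by rewrite ltn_double.
have od (i : 'I_k) : i.*2.+1 < k.*2 by rewrite ltn_Sdouble.
(* Using even positions for [a] and odd ones for [b] yields [a i != b i] as well, and the extra
   edges [adj (a i) (b i)] make both families injective. *)
exists (fun i => (nth x0 s i.*2).1), (fun i => (nth x0 s i.*2.+1).2).
have inj T (h : 'I_k -> T) : (forall i j : 'I_k, i < j -> h i <> h j) -> injective h.
  move=> hlt i j e; apply: val_inj; case: (ltngtP i j) => // ij.
    by case: (hlt _ _ ij).
  by case: (hlt _ _ ij).
split.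
- apply: inj => i j ij e; have := adjT _ _ (ltnSn i.*2) (od i).
  by rewrite e; apply/negP/adjF; rewrite ?ev // ltn_Sdouble.
- apply: inj => i j ij e; have := adjT _ _ (ltnSn j.*2) (od j).
  by rewrite -e; apply/negP/adjF; rewrite ?ev // ltn_Sdouble.
- by move=> i j; rewrite ne //; apply/eqP => e; have := congr1 odd e; rewrite /= !odd_double.
move=> i j ij; split.
  by apply: adjT => //; rewrite ltnS leq_double ltnW.
by rewrite adj_sym; apply: adjF; rewrite // ltn_Sdouble.
Qed.

Lemma stable_DEq_bounded k : exists d, forall (R : realType) (G : sgraph),
  sign_rank R G <= 3 -> chain_index G <= k -> DEq (@adj G) <= d.
Proof.
have [n hn] := seq_has_chain k.+1; have [d hd] := rank3_DEq_bounded n.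
exists d.+1 => R G + /chain_index_le_iff hk.
rewrite /sign_rank; case: ex_minnP => r /asboolP[A AG <-] _ A3.
pose M (x y : G) := (0 < A (enum_rank x) (enum_rank y))%R.
have Madj x y : x != y -> M x y = adj x y.
  move=> /AG; rewrite /M; case: (adj x y) => // h.
  by apply/negbTE; rewrite -leNgt ltW.
have [||t td tM] := hd R G G A M A3 => //.
  move=> s cs; rewrite ltnNge; apply/negP => ns.
  by have := hk _ (hn G M s Madj cs ns); rewrite ltnn.
apply/DEq_le_iff.
(* The diagonal of [A] is unconstrained, so a first query for [x = y] settles it. *)
exists (EqNode (fun x : G => enum_rank x) (fun y : G => enum_rank y) t (EqLeaf false)).
  by rewrite /= maxn0.
move=> x y _ _ /=; rewrite (inj_eq val_inj) (inj_eq enum_rank_inj).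
by case: eqVneq => [->|xy]; rewrite ?adj_irr // tM ?inE // Madj.
Qed.

Lemma bi_stable_DEq_bounded k : exists d, forall (R : realType) (G : bigraph),
  bi_sign_rank R G <= 3 -> chain_index (sgraph_of_bi G) <= k -> DEq (@edge G) <= d.
Proof.
have [n hn] := seq_has_chain k.+1; have [d hd] := rank3_DEq_bounded n.
exists d => R G + /chain_index_le_iff hk.
rewrite /bi_sign_rank; case: ex_minnP => r /asboolP[A AG <-] _ A3.
apply/DEq_le_iff; apply: (hd R _ _ A) => // [x y|s cs].
  by have [_ [h1 h2]] := AG x y; apply/idP/idP.
pose s' := [seq (inl u.1, inr u.2) : sgraph_of_bi G * sgraph_of_bi G | u <- s].
have cs' : chain (@adj (sgraph_of_bi G)) setT setT s'.
  by move: cs; rewrite !chainT pairwise_map.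
rewrite ltnNge -(size_map (fun u => (inl u.1, inr u.2) : sgraph_of_bi G * sgraph_of_bi G)).
apply/negP => ns; have := hk _ (hn _ _ s' (fun _ _ _ => erefl) cs' ns).
by rewrite ltnn.
Qed.

(** * Bipartite graphs viewed as graphs *)

Section Unfold.
Variable (G : bigraph).

Definition left_key (a : lpart G -> nat) (u : lpart G + rpart G) :=
  if u is inl x then a x else 0.
Definition right_key (b : rpart G -> nat) (u : lpart G + rpart G) :=
  if u is inr y then b y else 0.

Fixpoint eqtree_lr (t : eqtree (lpart G) (rpart G)) :=
  match t with
  | EqLeaf b => EqLeaf b
  | EqNode a b l r => EqNode (left_key a) (right_key b) (eqtree_lr l) (eqtree_lr r)
  end.

Fixpoint eqtree_rl (t : eqtree (lpart G) (rpart G)) :=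
  match t with
  | EqLeaf b => EqLeaf b
  | EqNode a b l r => EqNode (right_key b) (left_key a) (eqtree_rl l) (eqtree_rl r)
  end.

(** One query detects vertices on the same side, a second one orients the pair. This reduces one
    bipartite implication to [DEq_bounded_stable]. *)
Lemma DEq_sgraph_of_bi : DEq (@adj (sgraph_of_bi G)) <= (DEq (@edge G)).+2.
Proof.
have /DEq_le_iff[t td tM] := leqnn (DEq (@edge G)).
pose side (u : lpart G + rpart G) : nat := if u is inl _ then 0 else 1.
apply/DEq_le_iff; exists (EqNode side side
  (EqNode side (fun=> 0) (eqtree_rl t) (eqtree_lr t)) (EqLeaf false)).
  rewrite /= maxn0 !ltnS; apply: leq_trans td.
  have -> : eqtree_depth (eqtree_rl t) = eqtree_depth t by elim: (t) => //= a b l -> r ->.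
  have -> : eqtree_depth (eqtree_lr t) = eqtree_depth t by elim: (t) => //= a b l -> r ->.
  by rewrite maxnn.
move=> [x|x] [y|y] _ _ //=; rewrite -tM ?inE //.
  by elim: (t) => //= a b l -> r ->.
by elim: (t) => //= a b l -> r ->; rewrite eq_sym.
Qed.

End Unfold.

Theorem theorem4p10 (R : realType) :
  (forall C : sgraph -> Prop,
     graph_class C ->
     (forall G : sgraph, C G -> (sign_rank R G <= 3)%N) ->
     (DEq_bounded C <-> stable C))
  /\
  (forall C : bigraph -> Prop,
     bigraph_class C ->
     (forall G : bigraph, C G -> (bi_sign_rank R G <= 3)%N) ->
     (bi_DEq_bounded C <-> bi_stable C)).
Proof.
split=> C _ C3; split=> -[c hc].
- have [k hk] := DEq_bounded_stable c; exists k => G CG; exact/hk/hc.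
- have [d hd] := stable_DEq_bounded c; exists d => G CG.
  by apply: (hd R) (hc G CG); apply: C3.
- have [k hk] := DEq_bounded_stable c.+2; exists k => G CG; apply: hk.
  by apply: leq_trans (DEq_sgraph_of_bi G) _; rewrite !ltnS hc.
- have [d hd] := bi_stable_DEq_bounded c; exists d => G CG.
  by apply: (hd R) (hc G CG); apply: C3.
Qed.
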